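(* Let $L^{\mathrm{PI}}=\langle\{001101,001110,010101,010110,011001,011010,011100\}\rangle$. Then $L^{\mathrm{PI}}$ is 3-uniform and $\mathcal{G}_{L^{\mathrm{PI}}}$ is exactly the class $\mathrm{PI}$ of point-interval graphs.
   Context: For $L\subseteq\{0,1\}^*$, $\langle L\rangle$ is $L$ together with all words obtained from words of $L$ by exchanging $0$ and $1$. A binary word is 3-uniform if it contains exactly three $0$s and three $1$s. For a word $w$ and distinct letters $a,b$, $h_{a,b}(w)$ replaces $a$ by $0$, $b$ by $1$ and deletes other letters. For $L\subseteq\{0,1\}^*$ closed under exchanging $0$ and $1$ and a word $w$ with letter set $V$, $G(L,w)$ is the graph on $V$ where distinct $u,v$ are adjacent iff $h_{u,v}(w)\in L$; $\mathcal{G}_L$ is the class of graphs isomorphic to some $G(L,w)$. $\mathrm{PI}$ is the class of intersection graphs of triangles between two fixed parallel lines $L$ and $M$, where each triangle has exactly one corner on $L$ and two corners on $M$. *)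

(* Defs.v *)
From HB Require Import structures.
From mathcomp Require Import all_boot all_order all_algebra.
From mathcomp Require Import boolp classical_sets reals.

Set Implicit Arguments.
Unset Strict Implicit.
Unset Printing Implicit Defensive.

Import Order.TTheory GRing.Theory Num.Theory.

Record sgraph := SGraph {
  vertex :> finType;
  adj : rel vertex;
  adj_sym : symmetric adj;
  adj_irr : irreflexive adj }.

Definition isomorphic (G H : sgraph) : Prop :=
  exists2 f : G -> H, bijective f & forall x y, adj (f x) (f y) = adj x y.

(* The letter 0 is [false] and the letter 1 is [true]. *)
Definition word := seq bool.

Definition exchange : word -> word := map negb.

Lemma exchangeK : involutive exchange.
Proof. by move=> w; rewrite /exchange -map_comp map_id_in // => b _; case: b. Qed.

Record sym_language := SymLanguage {
  lang :> pred word;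
  lang_exchange : forall w, lang (exchange w) = lang w }.

Definition angle_pred (L : pred word) : pred word :=
  fun w => L w || L (exchange w).

Lemma angle_exchange (L : pred word) (w : word) :
  angle_pred L (exchange w) = angle_pred L w.
Proof. by rewrite /angle_pred exchangeK orbC. Qed.

(* <L>; a word arises from L by exchange iff its own exchange lies in L, since
   [exchange] is an involution. *)
Definition angle (L : pred word) : sym_language := SymLanguage (angle_exchange L).

Definition uniform_word (k : nat) (w : word) : Prop :=
  count_mem false w = k /\ count_mem true w = k.

Definition uniform (k : nat) (L : pred word) : Prop :=
  forall w, L w -> uniform_word k w.

(* h_{a,b}(w); meaningful for a != b. *)
Definition hproj (A : eqType) (a b : A) (w : seq A) : word :=
  [seq x == b | x <- w & (x == a) || (x == b)].

Lemma hproj_exchange (A : eqType) (a b : A) (w : seq A) :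
  a != b -> hproj b a w = exchange (hproj a b w).
Proof.
move=> ab; rewrite /hproj /exchange -map_comp.
rewrite (eq_filter (a2 := fun x => (x == a) || (x == b))); last first.
  by move=> x; rewrite orbC.
apply/eq_in_map => x; rewrite mem_filter => /andP[/orP[]/eqP-> _] /=.
  by rewrite eqxx (negbTE ab).
by rewrite eqxx eq_sym (negbTE ab).
Qed.

Section WordGraph.
Variables (L : sym_language) (A : choiceType) (w : seq A).

(* [seq_sub w] is the finite type of the letters occurring in w. *)
Definition word_adj : rel (seq_sub w) :=
  fun u v => (u != v) && L (hproj (val u) (val v) w).

Lemma word_adj_sym : symmetric word_adj.
Proof.
move=> u v; rewrite /word_adj eq_sym; case: (boolP (v == u)) => //= vu.
by rewrite (@hproj_exchange _ (val v) (val u)) ?lang_exchange ?(inj_eq val_inj).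
Qed.

Lemma word_adj_irr : irreflexive word_adj.
Proof. by move=> u; rewrite /word_adj eqxx. Qed.

Definition word_graph : sgraph := SGraph word_adj_sym word_adj_irr.

End WordGraph.

Definition word_class (L : sym_language) (G : sgraph) : Prop :=
  exists (A : choiceType) (w : seq A), isomorphic G (word_graph L w).

Local Notation O := false.
Local Notation I := true.

Definition LPI : sym_language := angle (mem
  [:: [:: O; O; I; I; O; I];
      [:: O; O; I; I; I; O];
      [:: O; I; O; I; O; I];
      [:: O; I; O; I; I; O];
      [:: O; I; I; O; O; I];
      [:: O; I; I; O; I; O];
      [:: O; I; I; I; O; O]]).

Local Open Scope classical_set_scope.
Local Open Scope ring_scope.

Section Plane.
Variable R : realType.
Local Notation plane := 'rV[R]_2.

Definition line (o d : plane) : set plane := [set o + t *: d | t in [set: R]].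

(* Two distinct parallel lines. *)
Definition parallel_lines (l m : set plane) : Prop :=
  exists o o' d : plane,
    [/\ d != 0, l = line o d, m = line o' d & l `&` m = set0].

(* The closed triangular region with corners a, b, c. *)
Definition triangle (a b c : plane) : set plane :=
  [set x | exists r s t : R,
     [/\ 0 <= r, 0 <= s, 0 <= t, r + s + t = 1 &
         x = r *: a + s *: b + t *: c]].

Definition point_interval_class (l m : set plane) (G : sgraph) : Prop :=
  exists a b c : G -> plane,
    (forall v, [/\ l (a v), m (b v), m (c v) & b v != c v]) /\
    (forall u v, u != v ->
       adj u v <->
       triangle (a u) (b u) (c u) `&` triangle (a v) (b v) (c v) !=set0).

End Plane.

(* Main.v *)
Require Import Defs.
From mathcomp Require Import all_boot all_order all_algebra.
From mathcomp Require Import boolp classical_sets reals.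
From mathcomp Require Import zify ring lra.

Set Implicit Arguments.
Unset Strict Implicit.
Unset Printing Implicit Defensive.

Import Order.TTheory GRing.Theory Num.Theory.

(** A 3-uniform word [h] over {0,1} lies outside [LPI] iff, up to exchanging 0 and
    1, its first 0 precedes its first 1 and its third 0 precedes its second 1.
    Reading the first occurrence of a letter as an apex and the next two as the
    ends of an interval, this says that the two triangles are disjoint.
    Conversely, a family of triangles becomes a word by listing the apexes from
    left to right and then the interval ends from left to right, with ties broken
    so that touching triangles stay adjacent. *)

(** * Order of occurrences and membership in [LPI] *)

(* Occurrences are numbered from 0: the [i]-th [u] comes before the [j]-th [v]. *)
Definition precedes (A : eqType) (u : A) (i : nat) (v : A) (j : nat) (w : seq A) :=
  has (fun n => (i < count_mem u (take n w)) && (count_mem v (take n w) <= j))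
      (iota 0 (size w).+1).

Lemma precedesP (A : eqType) (u : A) i (v : A) j (w : seq A) :
  reflect (exists s t, [/\ w = s ++ t, i < count_mem u s & count_mem v s <= j])
          (precedes u i v j w).
Proof.
apply: (iffP hasP) => [[n _ /andP[lt_i le_j]]|[s [t [-> lt_i le_j]]]].
  by exists (take n w), (drop n w); rewrite cat_take_drop.
exists (size s); first by rewrite mem_iota size_cat; lia.
by rewrite take_size_cat // lt_i.
Qed.

Lemma hproj_cat (A : eqType) (u v : A) (s t : seq A) :
  hproj u v (s ++ t) = hproj u v s ++ hproj u v t.
Proof. by rewrite /hproj filter_cat map_cat. Qed.

Lemma hproj_eq_cat (A : eqType) (u v : A) (w : seq A) (s t : word) :
  hproj u v w = s ++ t ->
  exists s' t', [/\ w = s' ++ t', hproj u v s' = s & hproj u v t' = t].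
Proof.
elim: w s => [|x w IH] s.
  by case: s => // e; exists [::], [::].
case: s => [e|b s]; first by exists [::], (x :: w).
rewrite /hproj /=; case: ifP => [uv_x [<- eq_w]|uv_x eq_w].
  have [s' [t' [-> <- <-]]] := IH s eq_w.
  by exists (x :: s'), t'; rewrite /hproj /= uv_x.
have [s' [t' [-> hs <-]]] := IH (b :: s) eq_w.
by exists (x :: s'), t'; rewrite -hs /hproj /= uv_x.
Qed.

Lemma count_false_hproj (A : eqType) (u v : A) (w : seq A) :
  u != v -> count_mem false (hproj u v w) = count_mem u w.
Proof.
move=> uv; rewrite /hproj; elim: w => //= x w IH.
have [-> | xu] := eqVneq x u; first by rewrite /= (negbTE uv) IH.
by case: (eqVneq x v) => [->|xv] /=; rewrite ?eqxx IH.
Qed.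

Lemma count_true_hproj (A : eqType) (u v : A) (w : seq A) :
  count_mem true (hproj u v w) = count_mem v w.
Proof.
rewrite /hproj; elim: w => //= x w IH.
by case: (eqVneq x v) => [->|xv] /=; rewrite ?eqxx ?orbT ?orbF /= ?eqxx ?IH //;
  case: ifP => _ //=; rewrite ?(negbTE xv) IH.
Qed.

Lemma precedes_hproj (A : eqType) (u v : A) i j (w : seq A) : u != v ->
  precedes false i true j (hproj u v w) = precedes u i v j w.
Proof.
move=> uv; apply/precedesP/precedesP => [[s [t [eq_w lt_i le_j]]]|].
  have [s' [t' [-> hs _]]] := hproj_eq_cat eq_w.
  exists s', t'; split=> //.
    by rewrite -(count_false_hproj _ uv) hs.
  by rewrite -(count_true_hproj u) hs.
move=> [s [t [-> lt_i le_j]]].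
exists (hproj u v s), (hproj u v t).
by rewrite hproj_cat count_false_hproj // count_true_hproj.
Qed.

Lemma precedes_hproj_sym (A : eqType) (u v : A) i j (w : seq A) : u != v ->
  precedes true i false j (hproj u v w) = precedes v i u j w.
Proof.
move=> uv; have vu : v != u by rewrite eq_sym.
rewrite -(precedes_hproj _ _ _ vu) (hproj_exchange _ uv).
move: (hproj u v w) => h; rewrite /precedes /exchange size_map.
by apply: eq_has => n; rewrite -map_take !count_map; congr (_ && _);
  congr (leq _ _); apply: eq_count; case.
Qed.

(* The six 3-uniform words missing from [LPI] are 000111, 001011, 010011 and
   their exchanges. *)
Lemma LPI_precedes (h : word) : uniform_word 3 h ->
  LPI h = ~~ (precedes false 0 true 0 h && precedes false 2 true 1 h ||
              precedes true 0 false 0 h && precedes true 2 false 1 h).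
Proof.
move=> [h0 h1]; have: size h = 6.
  rewrite -(count_predC (pred1 false)) h0.
  by rewrite (@eq_count _ _ (pred1 true)) ?h1 //; case.
(* The length is 6, so 64 words remain to be checked. *)
move: h h0 h1 => [|a [|b [|c [|d [|e [|f [|? ?]]]]]]] // + + _.
by case: a; case: b; case: c; case: d; case: e; case: f.
Qed.

Lemma LPI_uniform : uniform 3 LPI.
Proof.
have uniformL (w : word) : w \in
    [:: [:: false; false; true; true; false; true];
        [:: false; false; true; true; true; false];
        [:: false; true; false; true; false; true];
        [:: false; true; false; true; true; false];
        [:: false; true; true; false; false; true];
        [:: false; true; true; false; true; false];
        [:: false; true; true; true; false; false]] -> uniform_word 3 w.
  by rewrite !inE => /or4P[|||/or4P[]] /eqP->.
move=> w /orP[/uniformL //|/uniformL[]].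
rewrite /exchange !count_map => h0 h1; split.
  by rewrite -h1; apply: eq_count; case.
by rewrite -h0; apply: eq_count; case.
Qed.

(** * Positions of occurrences *)

Section Positions.
Variables (A : eqType) (w : seq A).

(* [p k] is the length of the shortest prefix containing [k.+1] occurrences. *)
Definition occurs_at (u : A) (p : nat -> nat) :=
  forall k n, k < 3 -> n <= size w ->
    (k < count_mem u (take n w)) = (p k <= n).

(** A prefix of length [n] is a witness iff [p i <= n < q j], so the shortest candidate [p i]
    decides. Three occurrences of [u] ensure that it does not exceed [size w]. *)
Lemma precedes_occurs_at (u v : A) (p q : nat -> nat) i j :
  i < 3 -> j < 3 -> count_mem u w = 3 ->
  occurs_at u p -> occurs_at v q -> precedes u i v j w = (p i < q j).
Proof.
move=> i3 j3 u3 pP qP; apply/hasP/idP => [[n]|lt_pq].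
  rewrite mem_iota add0n ltnS => /= le_n /andP[].
  rewrite pP // => le_p; rewrite leqNgt qP // -ltnNge.
  exact: leq_ltn_trans.
have le_p : p i <= size w by rewrite -pP // take_size u3.
exists (p i); first by rewrite mem_iota.
by rewrite pP // leqnn /= leqNgt qP // -ltnNge.
Qed.

Lemma LPI_occurs_at (u v : A) (p q : nat -> nat) : u != v ->
  count_mem u w = 3 -> count_mem v w = 3 ->
  occurs_at u p -> occurs_at v q ->
  LPI (hproj u v w) =
  ~~ ((p 0 < q 0) && (p 2 < q 1) || (q 0 < p 0) && (q 2 < p 1)).
Proof.
move=> uv u3 v3 pP qP; rewrite LPI_precedes; last first.
  by split; rewrite ?count_false_hproj ?count_true_hproj.
by rewrite !precedes_hproj // !precedes_hproj_sym //
  !(precedes_occurs_at _ _ u3 pP qP, precedes_occurs_at _ _ v3 qP pP).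
Qed.

(** The search stops before [size w]: on failure [find] returns [size w], the right value when [u]
    occurs more than [k] times. *)
Definition position (u : A) (k : nat) :=
  find (fun n => k < count_mem u (take n w)) (iota 0 (size w)).

Lemma occurs_at_position (u : A) :
  count_mem u w = 3 -> occurs_at u (position u).
Proof.
move=> u3 k n k3 le_n; rewrite /position; set P := fun n => _.
have mono m m' : m <= m' -> P m -> P m'.
  move=> le_m; rewrite /P => /leq_trans; apply.
  by rewrite -(subnKC le_m) takeD count_cat leq_addr.
apply/idP/idP => [Pn|le_f].
  have [lt_n|] := ltnP n (find P (iota 0 (size w))).
    have := before_find 0 lt_n.
    have lt_nw : n < size w.
      by apply: leq_trans lt_n _; rewrite -[X in _ <= X](size_iota 0) find_size.
    by rewrite nth_iota // add0n => /negP; case; exact: Pn.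
  by [].
apply: (mono _ _ le_f).
have [has_P|] := boolP (has P (iota 0 (size w))).
  have := nth_find 0 has_P; rewrite nth_iota ?add0n //.
  by rewrite -[X in _ < X](size_iota 0) -has_find.
move/hasNfind->; rewrite size_iota /P take_size u3 //.
Qed.

Lemma position_mono (u : A) i j : i <= j -> position u i <= position u j.
Proof.
move=> le_ij; rewrite /position; apply: sub_find => n /=.
exact: leq_ltn_trans.
Qed.

Lemma position_le (u : A) i : position u i <= size w.
Proof. by rewrite -[X in _ <= X](size_iota 0) find_size. Qed.

End Positions.

(** * Interval models, and models obtained from words *)

Definition left_of (T : porderType ring_display) (V : Type) (x lo hi : V -> T) (u v : V) :=
  ((x u < x v) && (hi u < lo v))%R.

(** The meeting point of the two classes: apex and base coordinates without the plane. Strictness of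
    [lo < hi] reflects distinct base corners. *)
Definition interval_model (R : realDomainType) (G : sgraph) :=
  exists x lo hi : G -> R,
    (forall v, (lo v < hi v)%R) /\
    (forall u v, u != v ->
       adj u v = ~~ (left_of x lo hi u v || left_of x lo hi v u)).

Section WordToModel.
Variables (A : choiceType) (w : seq A).

Let good (u : A) := count_mem u w == 3.

(* Letters that do not occur three times are isolated: they are put to the right
   of everything else, pairwise apart. *)
Let apex (u : A) :=
  if good u then (position w u 0).*2 else ((size w).*2 + (index u w).*2).+2.
Let lo (u : A) :=
  if good u then (position w u 1).*2 else ((size w).*2 + (index u w).*2).+2.
(** Doubling makes room for an odd right end: [lo < hi] follows from mere monotonicity of positions,
    and [p.*2.+1 < q.*2] still means [p < q]. The offset 2 in the other branch clears
    [(size w).*2.+1], the bound on [hi] for good letters. *)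
Let hi (u : A) :=
  if good u then (position w u 2).*2.+1 else ((size w).*2 + (index u w).*2).+3.

Lemma word_adj_left_of (u v : A) : u \in w -> v \in w -> u != v ->
  LPI (hproj u v w) = ~~ ((apex u < apex v) && (hi u < lo v) ||
                          (apex v < apex u) && (hi v < lo u)).
Proof.
move=> uw vw uv; rewrite /apex /lo /hi.
have pos_le a k : position w a k <= size w := position_le w a k.
have [/eqP u3|u3] := boolP (good u); have [/eqP v3|v3] := boolP (good v).
- rewrite (LPI_occurs_at uv u3 v3 (occurs_at_position u3) (occurs_at_position v3)).
  by congr (~~ (_ && _ || _ && _)); lia.
(* Some letter does not occur three times, so the projection is not 3-uniform and both sides are
   false. *)
all: transitivity false;
  [apply/negP => /LPI_uniform[c0 c1]|apply/esym/negbF].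
- by move: v3; rewrite /good -c1 count_true_hproj eqxx.
- by have := pos_le u 0; have := pos_le u 2; lia.
- by move: u3; rewrite /good -c0 count_false_hproj // eqxx.
- by have := pos_le v 0; have := pos_le v 2; lia.
- by move: v3; rewrite /good -c1 count_true_hproj eqxx.
- have: index u w != index v w.
    by apply: contraNneq uv => /(congr1 (nth u w)); rewrite !nth_index // => ->.
  lia.
Qed.

Lemma word_graph_model (R : realDomainType) (G : sgraph) :
  isomorphic G (word_graph LPI w) -> interval_model R G.
Proof.
move=> [f /bij_inj f_inj adjf].
exists (fun g => (apex (val (f g)))%:R%R), (fun g => (lo (val (f g)))%:R%R),
  (fun g => (hi (val (f g)))%:R%R); split=> [g|g g' neq].
  rewrite ltr_nat /lo /hi; case: ifP => // _.
  by have := @position_mono _ w (val (f g)) 1 2 isT; lia.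
have neqf : f g != f g' by rewrite (inj_eq f_inj).
rewrite -adjf -[LHS]/(word_adj LPI (f g) (f g')) /word_adj neqf andTb.
rewrite word_adj_left_of ?(valP (f _)) //.
by rewrite /left_of !ltr_nat.
Qed.

End WordToModel.

(** * Words obtained from interval models *)

Section ModelToWord.
Variables (R : realDomainType) (G : sgraph) (x lo hi : G -> R).
Hypothesis lo_hi : forall v, (lo v < hi v)%R.

(* Equal apexes mean adjacency, so they are sorted against the order of the
   intervals; touching intervals also do, so left ends precede right ends. *)
Let key (p : G * 'I_3) : bool *l (R *l R) :=
  match val p.2 with
  | 0 => (false, (x p.1, - lo p.1)%R)
  | 1 => (true, (lo p.1, 0%R))
  | _ => (true, (hi p.1, 1%R))
  end.

Let items := sort (relpre key <=%O) (enum {: G * 'I_3}).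
Let model_word := map fst items.
Let item (u : G) (k : nat) : G * 'I_3 := (u, inord k).
Let rank (u : G) (k : nat) := index (item u k) items.

Lemma mem_items p : p \in items.
Proof. by rewrite mem_sort mem_enum. Qed.

Lemma uniq_items : uniq items.
Proof. by rewrite sort_uniq enum_uniq. Qed.

Lemma key_rank u k v k' :
  rank u k <= rank v k' -> (key (item u k) <= key (item v k'))%O.
Proof.
move=> le_r; apply: (sorted_leq_index (leT := relpre key <=%O)) le_r.
- by move=> a b c; apply: le_trans.
- by move=> a; apply: lexx.
- by apply: sort_sorted => a b; apply: le_total.
- exact: mem_items.
- exact: mem_items.
Qed.

(** Distinct items may have equal keys, so only strict key comparisons force an order of ranks. *)
Lemma rank_lt u k v k' :
  (key (item u k) < key (item v k'))%O -> rank u k < rank v k'.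
Proof. by rewrite ltNge ltnNge; apply: contra; apply: key_rank. Qed.

Lemma rank01 u : rank u 0 < rank u 1.
Proof.
by apply: rank_lt; rewrite /key /= !inordK // ltxi_pair.
Qed.

Lemma rank12 u : rank u 1 < rank u 2.
Proof.
apply: rank_lt; rewrite /key /= !inordK // !ltxi_pair /= !(ltW (lo_hi u)) /=.
by rewrite leNgt lo_hi.
Qed.

Lemma rank_interval u v : (rank u 2 < rank v 1) = (hi u < lo v)%R.
Proof.
apply/idP/idP => [/ltnW/key_rank|lt_uv].
  rewrite /key /= !inordK // !lexi_pair /= => /andP[le_uv].
  (* At equal endpoints the last key components would require [1 <= 0]. *)
  by rewrite lt_neqAle le_uv andbT => imp; apply: contraL imp => /eqP ->;
     rewrite lexx /= -ltNge ltr01.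
by apply: rank_lt; rewrite /key /= !inordK // !ltxi_pair /= ltW //= leNgt lt_uv.
Qed.

(** Apex ranks follow [x] only up to ties, so the bases are compared first. If [hi u < lo v] and
    [x u = x v], then [lo u < lo v], and the component [- lo] puts the apex of [v] first. *)
Lemma rank_left_of u v :
  (rank u 0 < rank v 0) && (rank u 2 < rank v 1) = left_of x lo hi u v.
Proof.
rewrite rank_interval /left_of andbC [RHS]andbC.
case: (boolP (hi u < lo v)%R) => //= lt_uv.
apply/idP/idP => [/ltnW/key_rank|lt_x].
  rewrite /key /= !inordK // !lexi_pair /= => /andP[le_x].
  rewrite lt_neqAle le_x andbT => imp; apply: contraL imp => /eqP ->.
  by rewrite lexx /= lerN2 -ltNge (lt_trans (lo_hi u)).
by apply: rank_lt; rewrite /key /= !inordK // !ltxi_pair /= ltW //= leNgt lt_x.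
Qed.

Lemma count_model_word u n :
  count_mem u (take n model_word) =
  (rank u 0 < n) + (rank u 1 < n) + (rank u 2 < n).
Proof.
have countE s : count_mem u (map fst s) =
    count_mem (item u 0) s + count_mem (item u 1) s + count_mem (item u 2) s.
  elim: s => //= -[v i] s ->; rewrite /item !xpair_eqE /=.
  case: (v == u) => //=.
  case: i => [[|[|[|//]]] lti] /=; rewrite -!val_eqE /= !inordK //=; lia.
rewrite /model_word -map_take countE !count_uniq_mem ?take_uniq ?uniq_items //.
by rewrite !in_take ?mem_items.
Qed.

Lemma count_model_word3 u : count_mem u model_word = 3.
Proof.
rewrite -[model_word]take_size count_model_word size_map.
by rewrite !index_mem !mem_items.
Qed.

(** An item of index [r] first enters the prefix of length [r.+1]. The ranks of [u] increase, so
    item [k] is occurrence [k]. *)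
Lemma occurs_at_rank u : occurs_at model_word u (succn \o rank u).
Proof.
move=> k n k3 _; rewrite count_model_word /=.
have := rank01 u; have := rank12 u.
by case: k k3 => [|[|[|//]]] _; lia.
Qed.

Lemma model_word_class :
  (forall u v, u != v ->
     adj u v = ~~ (left_of x lo hi u v || left_of x lo hi v u)) ->
  word_class LPI G.
Proof.
move=> adjE.
have memw v : v \in model_word by rewrite -has_pred1 has_count count_model_word3.
exists G, model_word, (fun v => SeqSub (memw v)).
  by exists val => [v //|v]; apply: val_inj.
move=> u v; have [<-|uv] := eqVneq u v; first by rewrite !adj_irr.
rewrite -[LHS]/((u != v) && LPI (hproj u v model_word)) uv andTb.
rewrite (LPI_occurs_at uv _ _ (occurs_at_rank u) (occurs_at_rank v))
  ?count_model_word3 //.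
by rewrite /= !ltnS !rank_left_of adjE.
Qed.

End ModelToWord.

Lemma word_class_model (R : realDomainType) (G : sgraph) :
  word_class LPI G <-> interval_model R G.
Proof.
split=> [[A [w iso]]|[x [lo [hi [lo_hi adjE]]]]].
  exact: word_graph_model iso.
exact: model_word_class adjE.
Qed.

(** * Triangles between two parallel lines *)

Local Open Scope classical_set_scope.
Local Open Scope ring_scope.

Section Geometry.
Variables (R : realType) (o o' d : 'rV[R]_2).
Hypothesis d_neq0 : d != 0.
Hypothesis disj : line o d `&` line o' d = set0.

(** Unequal heights would make [o' - o] a multiple of [d] and put [o'] on both lines. *)
Lemma strip_coord_inj (h h' y y' : R) :
  o + h *: (o' - o) + y *: d = o + h' *: (o' - o) + y' *: d ->
  h = h' /\ y = y'.
Proof.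
move=> e.
have {}e : (h - h') *: (o' - o) = (y' - y) *: d.
  by apply/rowP => i; move/rowP/(_ i): e; rewrite !mxE => e; lra.
have [hh'|hh'] := eqVneq h h'.
  split=> //; move/eqP: e; rewrite hh' subrr scale0r eq_sym scaler_eq0.
  by rewrite (negbTE d_neq0) orbF subr_eq0 => /eqP.
suff : set0 o' by [].
rewrite -disj; split; last by exists 0 => //; rewrite scale0r addr0.
exists ((h - h')^-1 * (y' - y)) => //.
rewrite -scalerA -e scalerA mulVf ?subr_eq0 // scale1r.
by rewrite addrC subrK.
Qed.

(** The height depends on the apex weight alone, so a common point of two triangles has the same
    apex weight in both. *)
Lemma barycenter_strip (r s t x y z : R) : r + s + t = 1 ->
  r *: (o + x *: d) + s *: (o' + y *: d) + t *: (o' + z *: d) =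
  o + (1 - r) *: (o' - o) + (r * x + s * y + t * z) *: d.
Proof.
move=> e; have -> : r = 1 - s - t by lra.
by apply/rowP => i; rewrite !mxE; ring.
Qed.

Lemma triangleC (a b c : 'rV[R]_2) : triangle a b c = triangle a c b.
Proof.
have sub b' c' : triangle a b' c' `<=` triangle a c' b'.
  move=> _ [r [s [t [r0 s0 t0 e ->]]]]; exists r, t, s; split=> //.
    by rewrite addrAC.
  by rewrite addrAC.
by apply/seteqP; split; apply: sub.
Qed.

Lemma triangle_disjoint (x y z x' y' z' : R) :
  y <= z -> y' <= z' -> x < x' -> z < y' ->
  triangle (o + x *: d) (o' + y *: d) (o' + z *: d) `&`
  triangle (o + x' *: d) (o' + y' *: d) (o' + z' *: d) = set0.
Proof.
move=> yz yz' xx' zy'; apply/seteqP; split=> // q [].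
move=> [r [s [t [r0 s0 t0 e ->]]]] [r' [s' [t' [r0' s0' t0' e']]]].
rewrite !barycenter_strip // => /strip_coord_inj[hr hy].
have er : r' = r by lra.
rewrite er in e' hy.
have le1 : s * y <= s * z by rewrite ler_wpM2l.
have le2 : t' * y' <= t' * z' by rewrite ler_wpM2l.
have le3 : r * x <= r * x' by rewrite ler_wpM2l // ltW.
have eqs : s' + t' = s + t by lra.
(* With positive base weight, [z < y'] separates the points; otherwise both are apexes and [x < x']
   does. *)
have [st0|st0] := ltP 0 (s + t).
  have lt4 : (s + t) * z < (s + t) * y' by rewrite ltr_pM2l.
  have e5 : (s' + t') * y' = (s + t) * y' by rewrite eqs.
  by lra.
have sE : s = 0 by lra.
have tE : t = 0 by lra.
have s'E : s' = 0 by lra.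
have t'E : t' = 0 by lra.
have rE : r = 1 by lra.
by move: hy; rewrite rE sE tE s'E t'E; lra.
Qed.

(* The segments from [x] to [z] and from [x'] to [y'] cross. *)
Lemma triangle_meet (x y z x' y' z' : R) : x <= x' -> y' <= z ->
  triangle (o + x *: d) (o' + y *: d) (o' + z *: d) `&`
  triangle (o + x' *: d) (o' + y' *: d) (o' + z' *: d) !=set0.
Proof.
move=> xx' yz'.
pose D := (x' - x) + (z - y').
(* Both gaps are nonnegative, so [D = 0] makes the apexes coincide. *)
have [D0|D0] := eqVneq D 0.
  have -> : x' = x by move: D0; rewrite /D; lra.
  by exists (o + x *: d); split; exists 1, 0, 0;
     rewrite !scale0r scale1r !addr0; split.
have Dgt0 : 0 < D by rewrite lt_neqAle eq_sym D0 /D; lra.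
(* These weights solve [r * (x' - x) = s * (z - y')] with [r + s = 1]. *)
pose r := (z - y') / D; pose s := (x' - x) / D.
have r0 : 0 <= r by rewrite divr_ge0 ?subr_ge0 // ltW.
have s0 : 0 <= s by rewrite divr_ge0 ?subr_ge0 // ltW.
have rs : r + s = 1 by rewrite /r /s -mulrDl addrC divff.
have cross : r * x + s * z = r * x' + s * y' by rewrite /r /s; field.
exists (r *: (o + x *: d) + 0 *: (o' + y *: d) + s *: (o' + z *: d)); split.
  by exists r, 0, s; rewrite addr0.
exists r, s, 0; rewrite addr0; split=> //.
by rewrite !barycenter_strip ?addr0 // !mul0r !addr0 cross.
Qed.

Lemma triangle_meetP (x y z x' y' z' : R) : y <= z -> y' <= z' ->
  triangle (o + x *: d) (o' + y *: d) (o' + z *: d) `&`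
  triangle (o + x' *: d) (o' + y' *: d) (o' + z' *: d) !=set0 <->
  ~~ ((x < x') && (z < y') || (x' < x) && (z' < y)).
Proof.
move=> yz yz'; split.
  apply: contraPN => /orP[]/andP[lt1 lt2].
    by rewrite triangle_disjoint // => -[].
  by rewrite setIC triangle_disjoint // => -[].
rewrite negb_or !negb_and -!leNgt => /andP[/orP[le1|le1] /orP[le2|le2]].
- have <- : x = x' by apply/le_anti; rewrite le2 le1.
  by exists (o + x *: d); split; exists 1, 0, 0;
     rewrite !scale0r scale1r !addr0; split.
- by rewrite setIC; apply: triangle_meet.
- exact: triangle_meet.
(* The bases overlap, so either order of the apexes gives crossing segments. *)
- have [le3|/ltW le3] := leP x x'; first exact: triangle_meet.
  by rewrite setIC; apply: triangle_meet.
Qed.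

Lemma point_interval_model (G : sgraph) :
  point_interval_class (line o d) (line o' d) G <-> interval_model R G.
Proof.
split=> [[a [b [c [abcP adjP]]]]|[x [lo [hi [lo_hi adjE]]]]]; last first.
  exists (fun v => o + x v *: d), (fun v => o' + lo v *: d),
    (fun v => o' + hi v *: d); split=> [v|u v uv].
    split; [by exists (x v)|by exists (lo v)|by exists (hi v)|].
    rewrite (inj_eq (addrI o')) -subr_eq0 -scalerBl scaler_eq0.
    by rewrite (negbTE d_neq0) orbF subr_eq0 lt_eqF.
  by rewrite triangle_meetP ?ltW // adjE.
have /choice[x xP] v : exists t, o + t *: d = a v.
  by have [[t _ <-] _ _ _] := abcP v; exists t.
have /choice[y yP] v : exists t, o' + t *: d = b v.
  by have [_ [t _ <-] _ _] := abcP v; exists t.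
have /choice[z zP] v : exists t, o' + t *: d = c v.
  by have [_ _ [t _ <-] _] := abcP v; exists t.
(* The base corners come in no fixed order along the line. *)
exists x, (fun v => Num.min (y v) (z v)), (fun v => Num.max (y v) (z v)).
have triE v : triangle (a v) (b v) (c v) =
    triangle (o + x v *: d) (o' + Num.min (y v) (z v) *: d)
                            (o' + Num.max (y v) (z v) *: d).
  by rewrite -xP -yP -zP; case: leP => // _; rewrite triangleC.
split=> [v|u v uv].
  have [_ _ _] := abcP v; rewrite -yP -zP => bc.
  have yz : y v != z v by apply: contraNneq bc => ->.
  by case: (ltgtP (y v) (z v)) yz.
have min_max w : Num.min (y w) (z w) <= Num.max (y w) (z w).
  by rewrite ge_min !le_max lexx.
by apply/idP/idP => [/(adjP _ _ uv)|]; [|move=> nl; apply/(adjP _ _ uv); move: nl];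
   rewrite !triE triangle_meetP.
Qed.

End Geometry.

Theorem theorem6 (R : realType) (l m : set 'rV[R]_2)
    (lm : parallel_lines l m) :
  uniform 3 LPI /\
  forall G : sgraph, word_class LPI G <-> point_interval_class l m G.
Proof.
split=> [|G]; first exact: LPI_uniform.
case: lm => o [o' [d [d_neq0 -> -> disj]]].
by rewrite (word_class_model R) point_interval_model.
Qed.
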